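(* Suppose $Q$ is a compact Hausdorff and totally disconnected topological quandle. If $\mathrm{End}(Q)$ (respectively, $\mathrm{Aut}(Q)$) is compact in the compact-open topology, then $\mathrm{End}(Q)$ (respectively, $\mathrm{Aut}(Q)$) is a profinite monoid (respectively, a profinite group). Furthermore, the compact-open topology on it coincides with the topology of pointwise convergence.
   Context: A quandle is a non-empty set $Q$ with a binary operation $*$ such that $x*x=x$; for all $x,y$ there is a unique $z$ with $x=z*y$; and $(x*y)*z=(x*z)*(y*z)$. A topological quandle is a quandle with a topology such that $*:Q\times Q\to Q$ is continuous and each right multiplication $R_q:p\mapsto p*q$ is a homeomorphism of $Q$. For a topological quandle $Q$, $\mathrm{End}(Q)$ denotes the monoid under composition of continuous quandle endomorphisms and $\mathrm{Aut}(Q)$ the group of continuous quandle automorphisms, both topologized as subspaces of the space $C(Q,Q)$ of continuous maps with the compact-open topology. A profinite monoid (group) is a topological monoid (group) that is a projective limit of finite discrete monoids (groups). *)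

(* Defs.v *)
From HB Require Import structures.
From mathcomp Require Import all_boot all_classical topology.

Set Implicit Arguments.
Unset Strict Implicit.
Unset Printing Implicit Defensive.

Local Open Scope classical_set_scope.

Definition homeomorphism (S T : topologicalType) (f : S -> T) : Prop :=
  continuous f /\
  exists g : T -> S, [/\ continuous g, cancel f g & cancel g f].

HB.mixin Record isQuandle Q := {
  qop : Q -> Q -> Q;
  quandle_nonempty : [set: Q] !=set0;
  qopxx : forall x, qop x x = x;
  qop_div : forall x y, exists! z, x = qop z y;
  qop_distr : forall x y z, qop (qop x y) z = qop (qop x z) (qop y z)
}.

#[short(type="quandleType")]
HB.structure Definition Quandle := {Q of isQuandle Q}.

HB.mixin Record Quandle_isTopological Q of Quandle Q & Topological Q := {
  qop_continuous : continuous (fun p : Q * Q => qop p.1 p.2);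
  qop_homeomorphism : forall q : Q, homeomorphism (fun p : Q => qop p q)
}.

#[short(type="topologicalQuandleType")]
HB.structure Definition TopologicalQuandle :=
  {Q of Quandle Q & Topological Q & Quandle_isTopological Q}.

Definition quandle_morphism (P Q : quandleType) (f : P -> Q) : Prop :=
  {morph f : x y / qop x y}.

HB.structure Definition MonoidTopological := {M of Monoid M & Topological M}.
HB.structure Definition GroupTopological := {G of Group G & Topological G}.

Definition topological_monoid (M : MonoidTopological.type) : Prop :=
  continuous (fun p : M * M => (p.1 * p.2)%g).

Definition topological_group (G : GroupTopological.type) : Prop :=
  continuous (fun p : G * G => (p.1 * p.2)%g) /\
  continuous (fun x : G => (x^-1)%g).

(* [U] is a forgetful map to monoids: it is instantiated below by the identity
   of [monoidType] and by the inclusion of [groupType] in [monoidType], so that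
   systems of monoids and of groups share the construction of the limit. *)
Record finite_inverse_system (C : Type) (U : C -> monoidType) := {
  idx : Type;
  idx_le : idx -> idx -> Prop;
  idx_nonempty : [set: idx] !=set0;
  idx_refl : forall i, idx_le i i;
  idx_trans : forall i j k, idx_le i j -> idx_le j k -> idx_le i k;
  idx_directed : forall i j, exists k, idx_le i k /\ idx_le j k;
  obj : idx -> C;
  obj_finite : forall i, finite_set [set: U (obj i)];
  trans_map : forall i j, idx_le i j -> U (obj j) -> U (obj i);
  trans_map_morph : forall i j (ij : idx_le i j), monoid_morphism (trans_map ij);
  trans_map_id : forall i (ii : idx_le i i) x, trans_map ii x = x;
  trans_map_comp : forall i j k (ij : idx_le i j) (jk : idx_le j k)
    (ik : idx_le i k) x, trans_map ik x = trans_map ij (trans_map jk x)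
}.

Arguments obj {C U} f i : rename.

Section projective_limit.
Context (C : Type) (U : C -> monoidType) (S : finite_inverse_system U).

Definition lim_set :
    set (prod_topology (fun i : idx S => discrete_topology (U (obj S i)))) :=
  [set x | forall i j (ij : idx_le i j), trans_map ij (x j) = x i].

Definition proj_lim : Type := set_type lim_set.

HB.instance Definition _ := Topological.copy proj_lim (set_type lim_set).

Definition lim_coord (x : proj_lim) (i : idx S) : U (obj S i) := \val x i.

Lemma lim_coordP (x : proj_lim) i j (ij : idx_le i j) :
  trans_map ij (lim_coord x j) = lim_coord x i.
Proof. exact: (set_mem (valP x)). Qed.

Lemma lim_coord_inj (x y : proj_lim) :
  (forall i, lim_coord x i = lim_coord y i) -> x = y.
Proof. by move=> xy; apply: val_inj; apply: functional_extensionality_dep. Qed.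

Definition mk_lim (x : forall i, U (obj S i))
    (xP : forall i j (ij : idx_le i j), trans_map ij (x j) = x i) : proj_lim :=
  SigSub (mem_set (xP : lim_set x)).

Lemma lim_one_subproof i j (ij : idx_le i j) :
  trans_map ij (1 : U (obj S j))%g = 1%g.
Proof. exact: (trans_map_morph ij).1. Qed.

Lemma lim_mul_subproof (x y : proj_lim) i j (ij : idx_le i j) :
  trans_map ij (lim_coord x j * lim_coord y j)%g
    = (lim_coord x i * lim_coord y i)%g.
Proof. by rewrite (trans_map_morph ij).2 !lim_coordP. Qed.

Definition lim_one : proj_lim := mk_lim lim_one_subproof.
Definition lim_mul (x y : proj_lim) : proj_lim := mk_lim (lim_mul_subproof x y).

Lemma lim_mulA : associative lim_mul.
Proof. by move=> x y z; apply: lim_coord_inj => i; exact: mulgA. Qed.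

Lemma lim_mul1g : left_id lim_one lim_mul.
Proof. by move=> x; apply: lim_coord_inj => i; exact: mul1g. Qed.

Lemma lim_mulg1 : right_id lim_one lim_mul.
Proof. by move=> x; apply: lim_coord_inj => i; exact: mulg1. Qed.

HB.instance Definition _ :=
  isMonoid.Build proj_lim lim_mulA lim_mul1g lim_mulg1.

End projective_limit.

Definition profinite_monoid (M : MonoidTopological.type) : Prop :=
  topological_monoid M /\
  exists (S : finite_inverse_system (fun N : monoidType => N))
         (h : M -> proj_lim S), monoid_morphism h /\ homeomorphism h.

Definition profinite_group (G : GroupTopological.type) : Prop :=
  topological_group G /\
  exists (S : finite_inverse_system (fun H : groupType => H : monoidType))
         (h : G -> proj_lim S), monoid_morphism h /\ homeomorphism h.

(* With this import [continuousType Q Q] carries the compact-open topology, and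
   [set_type] below the corresponding subspace topology. *)
Import ArrowAsCompactOpen.

Definition end_set (Q : topologicalQuandleType) : set (continuousType Q Q) :=
  [set f | quandle_morphism f].

Definition qEnd (Q : topologicalQuandleType) : Type := set_type (@end_set Q).

Module EndTopology.
#[export] HB.instance Definition _ (Q : topologicalQuandleType) :=
  Topological.copy (qEnd Q) (set_type (@end_set Q)).
End EndTopology.
HB.export EndTopology.

Section EndQ.
Context (Q : topologicalQuandleType).

Definition End_fun (f : qEnd Q) : Q -> Q := \val f.

Lemma End_fun_inj (f g : qEnd Q) : End_fun f =1 End_fun g -> f = g.
Proof. by move=> fg; apply: val_inj; exact/continuousEP. Qed.

Lemma End_idP : end_set (@idfun Q).
Proof. by []. Qed.

Lemma End_compP (f g : qEnd Q) : end_set (\val f \o \val g).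
Proof.
move=> x y /=; have /set_mem fP := valP f; have /set_mem gP := valP g.
by rewrite gP fP.
Qed.

Definition End_one : qEnd Q := SigSub (mem_set End_idP).
Definition End_mul (f g : qEnd Q) : qEnd Q := SigSub (mem_set (End_compP f g)).

Lemma End_mulA : associative End_mul.
Proof. by move=> f g h; exact: End_fun_inj. Qed.

Lemma End_mul1g : left_id End_one End_mul.
Proof. by move=> f; exact: End_fun_inj. Qed.

Lemma End_mulg1 : right_id End_one End_mul.
Proof. by move=> f; exact: End_fun_inj. Qed.

HB.instance Definition _ := isMonoid.Build (qEnd Q) End_mulA End_mul1g End_mulg1.

Definition qEnd_ptws : topologicalType :=
  initial_topology (End_fun : qEnd Q -> {ptws Q -> Q}).

End EndQ.

Definition aut_set (Q : topologicalQuandleType) : set (continuousType Q Q) :=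
  [set f | quandle_morphism f /\ homeomorphism f].

Definition qAut (Q : topologicalQuandleType) : Type := set_type (@aut_set Q).

Module AutTopology.
#[export] HB.instance Definition _ (Q : topologicalQuandleType) :=
  Topological.copy (qAut Q) (set_type (@aut_set Q)).
End AutTopology.
HB.export AutTopology.

Section AutQ.
Context (Q : topologicalQuandleType).

Definition Aut_fun (f : qAut Q) : Q -> Q := \val f.

Lemma Aut_fun_inj (f g : qAut Q) : Aut_fun f =1 Aut_fun g -> f = g.
Proof. by move=> fg; apply: val_inj; exact/continuousEP. Qed.

Lemma Aut_idP : aut_set (@idfun Q).
Proof.
split=> //; split; first exact: cts_fun.
by exists idfun; split=> //; exact: cts_fun.
Qed.

Lemma Aut_compP (f g : qAut Q) : aut_set (\val f \o \val g).
Proof.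
have /set_mem [fM [_ [f' [f'c fK f'K]]]] := valP f.
have /set_mem [gM [_ [g' [g'c gK g'K]]]] := valP g.
split; first by move=> x y /=; rewrite gM fM.
split; first exact: cts_fun.
exists (g' \o f'); split; [|exact: can_comp|exact: can_comp].
by move=> x; apply: continuous_comp; [exact: f'c|exact: g'c].
Qed.

Lemma Aut_inv_subproof (f : qAut Q) :
  exists g : qAut Q, cancel (Aut_fun f) (Aut_fun g) /\
                   cancel (Aut_fun g) (Aut_fun f).
Proof.
have /set_mem [fM [fc [g [gc fK gK]]]] := valP f.
have gP : aut_set (mkcts gc).
  split; last by split=> //; exists (\val f).
  by move=> x y; apply: (can_inj fK); rewrite /mkcts fM !gK.
by exists (SigSub (mem_set gP)).
Qed.

Definition Aut_one : qAut Q := SigSub (mem_set Aut_idP).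
Definition Aut_mul (f g : qAut Q) : qAut Q := SigSub (mem_set (Aut_compP f g)).
Definition Aut_inv (f : qAut Q) : qAut Q := sval (cid (Aut_inv_subproof f)).

Lemma Aut_mulA : associative Aut_mul.
Proof. by move=> f g h; exact: Aut_fun_inj. Qed.

Lemma Aut_mul1g : left_id Aut_one Aut_mul.
Proof. by move=> f; exact: Aut_fun_inj. Qed.

Lemma Aut_mulg1 : right_id Aut_one Aut_mul.
Proof. by move=> f; exact: Aut_fun_inj. Qed.

Lemma Aut_mulVg : left_inverse Aut_one Aut_inv Aut_mul.
Proof.
by move=> f; apply: Aut_fun_inj; exact: (svalP (cid (Aut_inv_subproof f))).1.
Qed.

Lemma Aut_mulgV : right_inverse Aut_one Aut_inv Aut_mul.
Proof.
by move=> f; apply: Aut_fun_inj; exact: (svalP (cid (Aut_inv_subproof f))).2.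
Qed.

HB.instance Definition _ := isGroup.Build (qAut Q)
  Aut_mulA Aut_mul1g Aut_mulg1 Aut_mulVg Aut_mulgV.

Definition qAut_ptws : topologicalType :=
  initial_topology (Aut_fun : qAut Q -> {ptws Q -> Q}).

End AutQ.

(* Main.v *)
From HB Require Import structures.
Require Import Defs.
From mathcomp Require Import all_boot all_classical topology.

(** Both halves of the theorem are instances of a single fact: a compact
    topological monoid whose points are separated by clopen sets is the limit of
    its finite discrete quotients.

    Each clopen subset [A] of such a monoid [M] has a syntactic congruence,
    relating [x] and [y] when [a * x * b] and [a * y * b] are always on the same
    side of [A].  Since [M * M] is compact and membership in [A] is locally
    constant, its classes are open ([syntactic_open]); a monoid congruence with
    open classes has finite index, again by compactness.  Its classes do not
    cross the boundary of [A] (take [a = b = 1]).  So the open congruences form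
    a directed family with finite quotients whose classes are arbitrarily small,
    and [M] maps to the limit of these quotients: injectively because classes
    are small, onto because a compatible family of classes is a directed family
    of nonempty closed sets, and openly once more because classes are small
    ([limit_of_quotients]).  If [M] is a group then a monoid congruence is a
    group congruence ([cong_inv]), so the quotients are groups, and inversion is
    continuous because it maps small open classes into small classes.

    To apply this to [End Q] and [Aut Q] one checks that composition is
    continuous for the compact-open topology, [Q] being compact Hausdorff, and
    that clopen sets separate points: if [f x <> g x], pull back along the
    evaluation at [x] a clopen subset of [Q] separating [f x] from [g x].  That
    [Q] has enough clopen sets is the classical theorem that the intersection of
    the clopen neighbourhoods of a point of a compact Hausdorff space is
    connected ([quasicomponent_connected]).

    Finally, the map from the compact-open to the pointwise topology is a
    continuous injection of a compact space into a Hausdorff one, hence an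
    embedding ([compact_hausdorff_initial]). *)

Set Implicit Arguments.
Unset Strict Implicit.
Unset Printing Implicit Defensive.

Local Open Scope classical_set_scope.

(** * Clopen sets in compact spaces *)

(** Finite intersection property, in the form in which all the compactness
    arguments below use it; with [W = set0] it says that a directed family of
    nonempty closed sets has a common point. *)
Lemma directed_closed_sub (T : topologicalType) (I : Type) (F : I -> set T)
    (W : set T) :
    compact [set: T] -> inhabited I -> (forall i, closed (F i)) ->
    (forall i j, exists k, F k `<=` F i `&` F j) -> open W ->
  \bigcap_i F i `<=` W -> exists i, F i `<=` W.
Proof.
move=> Tcompact [i0] Fcl Fdir Wopen FW; apply: contrapT => /forallNP FnW.
pose G := filter_from [set: I] (fun i => F i `\` W).
have GF : ProperFilter G.
  apply: filter_from_proper.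
    apply: filter_from_filter; first by exists i0.
    move=> i j _ _; have [k kij] := Fdir i j.
    by exists k => // x [/kij[]].
  move=> i _; apply: contrapT => /set0P/negP/negPn/eqP.
  by rewrite setD_eq0; exact: FnW.
have [|x [_ xG]] := Tcompact G GF; first exact: filterT.
have xcl A : closed A -> G A -> A x.
  by move=> Acl GA; apply: Acl => B; exact: xG.
have : (~` W) x.
  by apply: xcl; [exact: open_closedC | exists i0 => // y []].
by apply; apply: FW => i _; apply: xcl => //; exists i => // y [].
Qed.

Definition quasicomponent (T : topologicalType) (x : T) : set T :=
  \bigcap_(A in [set A | clopen A /\ A x]) A.

Lemma quasicomponent_sub_open (T : topologicalType) (x : T) (W : set T) :
    compact [set: T] -> open W -> quasicomponent x `<=` W ->
  exists A, [/\ clopen A, A x & A `<=` W].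
Proof.
move=> Tcompact Wopen xW.
have [|||||[A [Ac Ax]] /= AW] := @directed_closed_sub T
    {A : set T | clopen A /\ A x} sval W Tcompact.
- by constructor; exists setT; split=> //; exact: clopenT.
- by move=> [A [[]]].
- move=> [A [Ac Ax]] [B [Bc Bx]].
  by exists (exist _ (A `&` B) (conj (clopenI Ac Bc) (conj Ax Bx))).
- exact: Wopen.
- by move=> y yA; apply: xW => A Ax; exact: (yA (exist _ A Ax)).
- by exists A.
Qed.

(** Suppose that the quasicomponent is the disjoint union of closed sets [B],
    containing [x], and [C].  By normality some open [U] around [B] lies in a set
    [V] whose closure misses [C], and then some clopen neighbourhood [N] of [x]
    lies in the union of [U] and the complement of [closure V].  So
    [N `&` U = N `&` closure V] is a clopen neighbourhood of [x], whence it
    contains [C], and [C] is empty. *)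
Lemma quasicomponent_connected (T : topologicalType) (x : T) :
    compact [set: T] -> hausdorff_space T -> connected (quasicomponent x).
Proof.
move=> Tcompact Thaus; set K := quasicomponent x.
have Kcl : closed K by apply: closed_bigI => A [[]].
have Ksub A : clopen A -> A x -> K `<=` A by move=> Ac Ax z; exact.
have Kx : K x by move=> A [].
have no_split B C : closed B -> closed C -> B `&` C = set0 -> K = B `|` C ->
    B x -> C = set0.
  move=> Bcl Ccl BC KBC Bx.
  have [|V BV VC] := compact_normal Thaus Tcompact Bcl (t := ~` C).
    apply/set_nbhsP; exists (~` C); split=> //; first exact: closed_openC.
    exact/disjoints_subset.
  have {BV} [U [Uo BU UV]] := (set_nbhsP _ _).1 BV.
  have [||N [[No Nc] Nx NW]] := @quasicomponent_sub_open T x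
      (U `|` ~` closure V) Tcompact.
  - by apply: openU => //; apply: closed_openC; exact: closed_closure.
  - rewrite -/K KBC => z [/BU|Cz]; [by left | right=> /VC]; exact.
  have NU : N `&` U = N `&` closure V.
    apply/seteqP; split=> z [Nz]; first by move/UV/subset_closure.
    by move=> Vz; split=> //; have [|] := NW _ Nz.
  apply/seteqP; split=> // z Cz; apply: (VC z) => //.
  have : (N `&` U) z.
    apply: Ksub; last by rewrite KBC; right.
    - split; first exact: openI.
      by rewrite NU; apply: closedI => //; exact: closed_closure.
    - by split=> //; exact: BU.
  by rewrite NU => -[].
move=> B [b Bb] [C Co BC] [D Dcl BD].
have Bcl : closed B by rewrite BD; exact: closedI.
have KBcl : closed (K `\` B).
  have -> : K `\` B = K `&` ~` C.
    apply/seteqP; split=> z [Kz Bz]; split=> // Cz; apply: Bz.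
      by rewrite BC.
    by move: Cz; rewrite BC => -[].
  by apply: closedI => //; exact: open_closedC.
have BK : B `<=` K by rewrite BC => z [].
have KE : K = B `|` K `\` B by rewrite setDUK.
have [Bx|nBx] := pselect (B x).
  have KB0 : K `\` B = set0 by apply: (no_split B) => //; exact: setDIK.
  by rewrite KE KB0 setU0.
have B0 : B = set0.
  apply: (no_split (K `\` B)) => //; first by rewrite setDKI.
  by rewrite setUC.
by rewrite B0 in Bb.
Qed.

Lemma compact_totally_disconnected_zero_dimensional (T : topologicalType) :
    compact [set: T] -> hausdorff_space T -> totally_disconnected [set: T] ->
  zero_dimensional T.
Proof.
move=> Tcompact Thaus Ttd x y xy; apply: contrapT => noclopen.
have Kx : quasicomponent x x by move=> A [].
have Ky : quasicomponent x y.
  by move=> A [Ac Ax]; apply: contrapT => Ay; apply: noclopen; exists A.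
have : connected_component [set: T] x y.
  have Kconn := @quasicomponent_connected T x Tcompact Thaus.
  exact: (connected_component_max Kx _ Kconn).
by rewrite (Ttd x I) => /= yx; rewrite yx eqxx in xy.
Qed.

Lemma zero_dimensional_clopen_nbhs (T : topologicalType) (x : T) (W : set T) :
    compact [set: T] -> zero_dimensional T -> nbhs x W ->
  exists A, [/\ clopen A, A x & A `<=` W].
Proof.
move=> Tcompact Tzd Wx.
have [||A [Ac Ax AW]] := @quasicomponent_sub_open T x W° Tcompact.
- exact: open_interior.
- move=> y yA; suff -> : y = x by [].
  apply/eqP/negPn/negP; rewrite eq_sym => /Tzd[A [Ac Ax]]; apply.
  exact: yA.
- by exists A; split=> // y /AW; exact: interior_subset.
Qed.

(** A continuous map from a compact to a Hausdorff space is closed. *)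
Lemma compact_hausdorff_initial (T Y : topologicalType) (f : T -> Y) :
    compact [set: T] -> hausdorff_space Y -> continuous f -> injective f ->
  forall A : set T, open A <-> @open (initial_topology f) A.
Proof.
move=> Tcompact Yhaus fc fI A; split=> [Ao|[B Bo <-]]; last first.
  by move/continuousP : fc; exact.
exists (~` (f @` (~` A))).
  apply: closed_openC; apply: compact_closed => //; apply: continuous_compact.
    exact: continuous_subspaceT.
  by apply: (subclosed_compact _ Tcompact) => //; exact: open_closedC.
apply/seteqP; split=> x /=.
  by move=> nAx; apply: contrapT => Ax; apply: nAx; exists x.
by move=> Ax [y Ay /fI yx]; apply: Ay; rewrite yx.
Qed.

Local Open Scope quotient_scope.
Local Open Scope group_scope.

(** * Congruences and quotients *)

Record congruence (M : monoidType) := Congruence {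
  cong :> rel M;
  cong_equiv : equiv_class_of cong;
  cong_mul : forall x x' y y', cong x x' -> cong y y' -> cong (x * y) (x' * y')
}.

Definition cong_rel (M : monoidType) (e : congruence M) : equiv_rel M :=
  EquivRelPack (cong_equiv e).

Lemma cong_refl (M : monoidType) (e : congruence M) : reflexive e.
Proof. by case: (cong_equiv e). Qed.

Lemma cong_sym (M : monoidType) (e : congruence M) : symmetric e.
Proof. by case: (cong_equiv e). Qed.

Lemma cong_trans (M : monoidType) (e : congruence M) : transitive e.
Proof. by case: (cong_equiv e). Qed.

Definition quotient_monoid (M : monoidType) (e : congruence M) : Type :=
  {eq_quot (cong_rel e)}.

HB.instance Definition _ (M : monoidType) (e : congruence M) :=
  Choice.on (quotient_monoid e).

Section QuotientMonoid.
Context (M : monoidType) (e : congruence M).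

Definition quot_pi (x : M) : quotient_monoid e :=
  \pi_({eq_quot (cong_rel e)}) x.

Lemma quot_piE x y : (quot_pi x = quot_pi y) <-> e x y.
Proof. by split=> [/eqquotP|?]; [|exact/eqquotP]. Qed.

Lemma quot_pi_surj (a : quotient_monoid e) : exists x, quot_pi x = a.
Proof. by exists (repr a); exact: reprK. Qed.

Definition quot_mul (a b : quotient_monoid e) : quotient_monoid e :=
  quot_pi (repr a * repr b).

Lemma quot_piM x y : quot_pi (x * y) = quot_mul (quot_pi x) (quot_pi y).
Proof.
by apply/quot_piE; apply: cong_mul; apply/quot_piE/esym; exact: reprK.
Qed.

Lemma quot_mulA : associative quot_mul.
Proof.
move=> a b c; have [x <-] := quot_pi_surj a; have [y <-] := quot_pi_surj b.
by have [z <-] := quot_pi_surj c; rewrite -!quot_piM mulgA.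
Qed.

Lemma quot_mul1g : left_id (quot_pi 1) quot_mul.
Proof. by move=> a; have [x <-] := quot_pi_surj a; rewrite -quot_piM mul1g. Qed.

Lemma quot_mulg1 : right_id (quot_pi 1) quot_mul.
Proof. by move=> a; have [x <-] := quot_pi_surj a; rewrite -quot_piM mulg1. Qed.

HB.instance Definition _ :=
  isMonoid.Build (quotient_monoid e) quot_mulA quot_mul1g quot_mulg1.

Lemma quot_pi_morphism : monoid_morphism quot_pi.
Proof. by split=> // x y; exact: quot_piM. Qed.

End QuotientMonoid.

Section QuotientGroup.
Context (G : groupType) (e : congruence G).

(** Multiply [x = y] in the quotient monoid by [x^-1] and [y^-1]. *)
Lemma cong_inv x y : e x y -> e x^-1 y^-1.
Proof.
move=> /quot_piE xy; apply/quot_piE.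
have -> : x^-1 = x^-1 * (y * y^-1) by rewrite mulgV mulg1.
by rewrite !quot_piM -xy quot_mulA -!quot_piM mulVg mul1g.
Qed.

Definition quot_inv (a : quotient_monoid e) : quotient_monoid e :=
  quot_pi e (repr a)^-1.

Lemma quot_piV x : quot_pi e x^-1 = quot_inv (quot_pi e x).
Proof. by apply/quot_piE/cong_inv/quot_piE/esym; exact: reprK. Qed.

Lemma quot_mulVg : left_inverse (quot_pi e 1) quot_inv (@quot_mul G e).
Proof.
by move=> a; have [x <-] := quot_pi_surj a; rewrite -quot_piV -quot_piM mulVg.
Qed.

Lemma quot_mulgV : right_inverse (quot_pi e 1) quot_inv (@quot_mul G e).
Proof.
by move=> a; have [x <-] := quot_pi_surj a; rewrite -quot_piV -quot_piM mulgV.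
Qed.

HB.instance Definition _ := hasInv.Build (quotient_monoid e) quot_inv.
HB.instance Definition _ :=
  Monoid_isGroup.Build (quotient_monoid e) quot_mulVg quot_mulgV.

End QuotientGroup.

(** * Open congruences of a topological monoid *)

Section OpenCongruence.
Context (M : MonoidTopological.type).

Record open_congruence := OpenCongruence {
  ocong :> congruence M;
  ocong_open : forall x, open [set y | ocong x y]
}.

Lemma full_equiv : equiv_class_of (fun _ _ : M => true).
Proof. by []. Qed.

Lemma full_open (x : M) : open [set y : M | (fun _ _ : M => true) x y].
Proof.
by have -> : [set _ : M | true] = setT; [exact/seteqP | exact: openT].
Qed.

Definition full_congruence : open_congruence :=
  @OpenCongruence (@Congruence M _ full_equiv (fun _ _ _ _ _ _ => isT))
    full_open.

Lemma meet_equiv (e e' : congruence M) :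
  equiv_class_of (fun x y => e x y && e' x y).
Proof.
constructor=> [x|x y|y x z /andP[xy xy'] /andP[yz yz']].
- by rewrite !cong_refl.
- by rewrite (cong_sym e) (cong_sym e').
- by rewrite (cong_trans xy yz) (cong_trans xy' yz').
Qed.

Lemma meet_mul (e e' : congruence M) x x' y y' :
    e x x' && e' x x' -> e y y' && e' y y' ->
  e (x * y) (x' * y') && e' (x * y) (x' * y').
Proof. by move=> /andP[? ?] /andP[? ?]; rewrite !cong_mul. Qed.

Lemma meet_open (e e' : open_congruence) x : open [set y | e x y && e' x y].
Proof.
have -> : [set y | e x y && e' x y] = [set y | e x y] `&` [set y | e' x y].
  by apply/seteqP; split=> y /andP.
by apply: openI; exact: ocong_open.
Qed.

Definition meet_congruence (e e' : open_congruence) : open_congruence :=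
  @OpenCongruence (Congruence (meet_equiv e e') (@meet_mul e e'))
    (meet_open e e').

(** The coarsest congruence of which [U] is a union of classes. *)
Definition syntactic (U : set M) : rel M :=
  fun x y => `[< forall a b, U (a * x * b) <-> U (a * y * b) >].

Lemma syntactic_equiv U : equiv_class_of (syntactic U).
Proof.
constructor=> [x|x y|y x z /asboolP xy /asboolP yz]; first exact/asboolP.
  by apply/asboolP/asboolP => xy a b; have [] := xy a b; split.
by apply/asboolP => a b; rewrite xy.
Qed.

Lemma syntactic_mul U x x' y y' :
  syntactic U x x' -> syntactic U y y' -> syntactic U (x * y) (x' * y').
Proof.
move=> /asboolP xx' /asboolP yy'; apply/asboolP => a b.
by have := yy' (a * x') b; have := xx' a (y * b); rewrite !mulgA => -> ->.
Qed.

Definition syntactic_congruence U : congruence M :=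
  Congruence (syntactic_equiv U) (@syntactic_mul U).

Lemma syntactic_mem U x y : syntactic U x y -> U x -> U y.
Proof. by move=> /asboolP/(_ 1 1); rewrite !mul1g !mulg1 => -[]. Qed.

(** Near each point [(a, b, z)] the truth value of [U (a * y * b)] is constant;
    compactness of [M * M] gives one neighbourhood of [z] for all [(a, b)]. *)
Lemma syntactic_open U : compact [set: M] -> topological_monoid M -> clopen U ->
  forall x, open [set y | syntactic_congruence U x y].
Proof.
move=> Mcompact Mtop [Uo Uc] x.
have nearx z : \forall y \near z,
    forall p : M * M, U (p.1 * z * p.2) <-> U (p.1 * y * p.2).
  have /compact_near_coveringP MM : compact [set: M * M].
    by rewrite -setXTT; exact: compact_setX.
  have := MM M (nbhs z) (fun y p => U (p.1 * z * p.2) <-> U (p.1 * y * p.2)) _.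
  suff near2 (p : M * M) : [set: M * M] p -> \forall q \near p & y \near z,
      U (q.1 * z * q.2) <-> U (q.1 * y * q.2).
    by move=> /(_ _ near2); apply: filterS => y yP p; exact: yP.
  move=> _; pose f (w : (M * M) * M) := w.1.1 * w.2 * w.1.2.
  have fc : continuous f.
    move=> w; apply: (@continuous2_cvg _ _ _ _ _ _ (fun w => w.1.1 * w.2)
      (fun w : M * M * M => w.1.2) (fun x y : M => x * y)).
    - exact: (Mtop (_, _)).
    - apply: (@continuous2_cvg _ _ _ _ _ _ (fun w : M * M * M => w.1.1)
        (fun w : M * M * M => w.2) (fun x y : M => x * y)).
      + exact: (Mtop (_, _)).
      + by apply: cvg_comp; [exact: cvg_fst | exact: cvg_fst].
      + exact: cvg_snd.
    - by apply: cvg_comp; [exact: cvg_fst | exact: cvg_snd].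
  have [[Q Y] [Qp Yz] QY] : nbhs (p, z) [set w | U (f w) <-> U (f (p, z))].
    have [Up|Up] := pselect (U (f (p, z))).
      have : nbhs (p, z) (f @^-1` U) by apply: fc; exact: open_nbhs_nbhs.
      by apply: filterS => w Uw; split.
    have : nbhs (p, z) (f @^-1` ~` U).
      by apply: fc; apply: open_nbhs_nbhs; split=> //; exact: closed_openC.
    by apply: filterS => w Uw; split.
  exists (Q, Y) => //= -[q y] [/= Qq Yy].
  have yE := QY (q, y) (conj Qq Yy).
  exact: iff_trans (QY (q, z) (conj Qq (nbhs_singleton Yz))) (iff_sym yE).
rewrite openE => y /= xy; apply: filterS (nearx y) => z yz.
apply: (@cong_trans M (syntactic_congruence U) y) => //.
by apply/asboolP => a b; exact: (yz (a, b)).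
Qed.

End OpenCongruence.

(** * The limit of the quotients by open congruences *)

(** The quotients are abstract here, characterized up to isomorphism by the
    surjections [proj e]; so the same argument serves monoids and groups. *)
Section LimitOfQuotients.
Context (C : Type) (U : C -> monoidType) (M : MonoidTopological.type).
Context (Mcompact : compact [set: M]) (Mtop : topological_monoid M).
Context (Mzd : zero_dimensional M).
Context (quot : open_congruence M -> C).
Context (proj : forall e, M -> U (quot e)).
Context (proj_morph : forall e, monoid_morphism (@proj e)).
Context (proj_surj : forall e a, exists x, @proj e x = a).
Context (projE : forall e x y, @proj e x = @proj e y <-> e x y).

Definition coarser (e e' : open_congruence M) := forall x y, e' x y -> e x y.

(** The complements of finite unions of classes are closed, directed, and have
    empty intersection, so that one of them is empty. *)
Lemma finite_quotient e : finite_set [set: U (quot e)].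
Proof.
pose F (s : seq M) := [set y | forall x, x \in s -> ~ e x y].
have [|||||s Fs] := @directed_closed_sub M (seq M) F set0 Mcompact.
- by constructor; exact: nil.
- move=> s; have -> : F s = \bigcap_(x in [set` s]) ~` [set y | e x y] by [].
  by apply: closed_bigI => x _; apply: open_closedC; exact: ocong_open.
- move=> s t; exists (s ++ t) => y yst; split=> x xs; apply: yst.
    by rewrite mem_cat xs.
  by rewrite mem_cat xs orbT.
- exact: open0.
- move=> y /(_ [:: y] I y); rewrite inE eqxx => /(_ isT); apply.
  exact: cong_refl.
have -> : [set: U (quot e)] = @proj e @` [set` s].
  apply/seteqP; split=> // a _; have [y <-] := proj_surj a.
  apply: contrapT => ys; apply: (Fs y) => x xs xy; apply: ys.
  by exists x => //; exact/projE.
exact: finite_image.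
Qed.

Definition proj_inv e (a : U (quot e)) : M := sval (cid (proj_surj a)).

Lemma proj_invK e : cancel (@proj_inv e) (@proj e).
Proof. by move=> a; exact: (svalP (cid (proj_surj a))). Qed.

Definition quot_trans e e' (ee' : coarser e e') (a : U (quot e')) :
    U (quot e) :=
  proj e (proj_inv a).

Lemma quot_trans_proj e e' (ee' : coarser e e') x :
  quot_trans ee' (proj e' x) = proj e x.
Proof. by apply/projE/ee'/projE; exact: proj_invK. Qed.

Lemma quot_trans_morph e e' (ee' : coarser e e') :
  monoid_morphism (quot_trans ee').
Proof.
split=> [|a b].
  by rewrite -(proj_morph e').1 quot_trans_proj (proj_morph e).1.
rewrite -[a]proj_invK -[b]proj_invK -(proj_morph e').2 !quot_trans_proj.
exact: (proj_morph e).2.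
Qed.

Lemma quot_trans_id e (ee : coarser e e) a : quot_trans ee a = a.
Proof. exact: proj_invK. Qed.

Lemma quot_trans_comp e e' e'' (ee' : coarser e e') (e'e'' : coarser e' e'')
    (ee'' : coarser e e'') a :
  quot_trans ee'' a = quot_trans ee' (quot_trans e'e'' a).
Proof. by rewrite -[a]proj_invK !quot_trans_proj. Qed.

Lemma coarser_directed e e' : exists e'', coarser e e'' /\ coarser e' e''.
Proof. by exists (meet_congruence e e'); split=> x y /andP[]. Qed.

Definition quotient_system : finite_inverse_system U := {|
  idx_le := coarser;
  idx_nonempty := ex_intro _ (full_congruence M) I;
  idx_refl := fun e x y exy => exy;
  idx_trans := fun e e' e'' ee' e'e'' x y xy => ee' x y (e'e'' x y xy);
  idx_directed := coarser_directed;
  obj_finite := finite_quotient;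
  trans_map_morph := quot_trans_morph;
  trans_map_id := quot_trans_id;
  trans_map_comp := quot_trans_comp
|}.

Definition to_lim (x : M) : proj_lim quotient_system :=
  @mk_lim C U quotient_system (fun e => proj e x)
    (fun e e' ee' => quot_trans_proj ee' x).

Lemma to_lim_morphism : monoid_morphism to_lim.
Proof.
split=> [|x y]; apply: lim_coord_inj => e; first exact: (proj_morph e).1.
exact: (proj_morph e).2.
Qed.

Lemma to_lim_inj : injective to_lim.
Proof.
move=> x y xy; apply/eqP/negPn/negP => /Mzd[A [Ac Ax]]; apply.
pose e := OpenCongruence (syntactic_open Mcompact Mtop Ac).
apply: (syntactic_mem _ Ax).
by apply/(projE e); rewrite -[LHS]/(lim_coord (to_lim x) e) xy.
Qed.

(** A point of the limit is a directed family of classes, which are clopen and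
    nonempty. *)
Lemma to_lim_surj t : exists x, to_lim x = t.
Proof.
pose F e := [set x | proj e x = lim_coord t e].
suff [x xt] : \bigcap_e F e !=set0.
  by exists x; apply: lim_coord_inj => e; exact: xt.
apply: contrapT => /set0P/negP/negPn/eqP F0.
have [|||||e Fe] := @directed_closed_sub M (open_congruence M) F set0 Mcompact.
- by constructor; exact: (full_congruence M).
- move=> e; rewrite -openC.
  have -> : ~` F e = \bigcup_(x in ~` F e) [set y | e x y].
    apply/seteqP; split=> y Fy.
      by exists y => //; exact: cong_refl.
    by have [x Fx /projE xy] := Fy; rewrite /F /= -xy.
  by apply: bigcup_open => x _; exact: ocong_open.
- move=> e e'; exists (meet_congruence e e') => x Fx.
  have ee : coarser e (meet_congruence e e') by move=> ? ? /andP[].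
  have ee' : coarser e' (meet_congruence e e') by move=> ? ? /andP[].
  split; rewrite /F /=.
    by rewrite -(quot_trans_proj ee x) Fx; exact: (lim_coordP t ee).
  by rewrite -(quot_trans_proj ee' x) Fx; exact: (lim_coordP t ee').
- exact: open0.
- by rewrite F0.
- by have [x xt] := proj_surj (lim_coord t e); exact: (Fe x).
Qed.

Lemma to_lim_continuous : continuous to_lim.
Proof.
apply: continuous_comp_initial => x; apply/cvg_sup => e.
move=> A /= [_ [[B _ <-] Bx BA]].
have : nbhs x [set y | e x y].
  apply: open_nbhs_nbhs; split; first exact: ocong_open.
  exact: cong_refl.
apply: filterS => y /projE xy; apply: BA.
by change (B (proj e y)); rewrite -xy.
Qed.

Lemma lim_coord_nbhs (t : proj_lim quotient_system) e :
  nbhs t [set s | lim_coord s e = lim_coord t e].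
Proof.
have val_continuous : continuous
    (\val : initial_topology (@set_val _ (@lim_set C U quotient_system)) -> _).
  exact: initial_continuous.
suff : nbhs (\val t) [set s | s e = lim_coord t e] by exact: val_continuous.
have /cvg_sup/(_ e) : nbhs (\val t) --> \val t by [].
apply; exists [set s | s e = lim_coord t e]; split=> //.
exists [set lim_coord t e] => //.
exact: (@discrete_open (discrete_topology (U (obj quotient_system e)))).
Qed.

Lemma limit_of_quotients :
  exists (S : finite_inverse_system U) (h : M -> proj_lim S),
    monoid_morphism h /\ homeomorphism h.
Proof.
exists quotient_system, to_lim; split; first exact: to_lim_morphism.
split; first exact: to_lim_continuous.
have [g gK] := choice to_lim_surj.
exists g; split=> //; last by move=> x; exact/to_lim_inj/gK.
(* The inverse is continuous at [t]: if [e] is syntactic for a clopen [B], then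
   [g] maps into [B] the points that agree with [t] at [e]. *)
move=> t A /= At.
have [B [Bc Bt BA]] := zero_dimensional_clopen_nbhs Mcompact Mzd At.
pose e := OpenCongruence (syntactic_open Mcompact Mtop Bc).
apply: filterS (lim_coord_nbhs t e) => s st; apply: BA.
apply: (syntactic_mem _ Bt); apply/(projE e).
by move: st; rewrite -{1}(gK s) -{1}(gK t).
Qed.

End LimitOfQuotients.

Lemma compact_zero_dimensional_profinite_monoid (M : MonoidTopological.type) :
    compact [set: M] -> zero_dimensional M -> topological_monoid M ->
  profinite_monoid M.
Proof.
move=> Mcompact Mzd Mtop; split=> //.
apply: (@limit_of_quotients monoidType (fun N => N) M Mcompact Mtop Mzd
  (fun e : open_congruence M => quotient_monoid e) (fun e => quot_pi e)).
- by move=> e; exact: quot_pi_morphism.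
- by move=> e; exact: quot_pi_surj.
- by move=> e x y; exact: quot_piE.
Qed.

(** Inversion maps the class of [x] into the class of [x^-1], and every
    neighbourhood of [x^-1] contains its class for some open congruence. *)
Lemma compact_zero_dimensional_inv_continuous (G : GroupTopological.type) :
    compact [set: G] -> zero_dimensional G -> topological_monoid G ->
  continuous (fun x : G => x^-1).
Proof.
move=> Gcompact Gzd Gtop x W /= Wx.
have [A [Ac Ax AW]] := zero_dimensional_clopen_nbhs Gcompact Gzd Wx.
have nx : nbhs x [set y | syntactic_congruence A x y].
  apply: open_nbhs_nbhs; split; last exact: cong_refl.
  exact: syntactic_open.
apply: filterS nx => y xy; apply: AW.
by apply: (syntactic_mem _ Ax); exact: (@cong_inv G (syntactic_congruence A)).
Qed.

Lemma compact_zero_dimensional_profinite_group (G : GroupTopological.type) :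
    compact [set: G] -> zero_dimensional G -> topological_monoid G ->
  profinite_group G.
Proof.
move=> Gcompact Gzd Gtop.
split; first by split=> //; exact: compact_zero_dimensional_inv_continuous.
apply: (@limit_of_quotients groupType (fun H => H) G Gcompact Gtop Gzd
  (fun e : open_congruence G => @quotient_monoid G e) (fun e => quot_pi e)).
- by move=> e; exact: quot_pi_morphism.
- by move=> e; exact: quot_pi_surj.
- by move=> e x y; exact: quot_piE.
Qed.

(** * Spaces of self-maps with the compact-open topology *)

Section CompactOpen.
Import ArrowAsCompactOpen.
Context (X : topologicalType) (A : set (continuousType X X)).
Context (Xcompact : compact [set: X]) (Xhaus : hausdorff_space X).

Definition subset_fun (f : set_type A) : X -> X := \val f.

Lemma val_continuous : continuous (\val : set_type A -> continuousType X X).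
Proof. exact: initial_continuous. Qed.

Lemma eval_at_continuous x : continuous (fun f : set_type A => subset_fun f x).
Proof.
apply/continuousP => O Oopen.
have -> : (fun f => subset_fun f x) @^-1` O
    = (fun f => subset_fun f : {compact-open, X -> X}) @^-1`
        [set g | g @` [set x] `<=` O].
  apply/seteqP; split=> f /=; first by move=> fx _ [_ -> <-].
  by apply; exists x.
have := compact_open_open (@compact_set1 X x) Oopen.
have id_continuous : continuous (id : continuousType X X -> (X -> X)).
  exact: initial_continuous.
have fun_continuous :
    continuous (fun f => subset_fun f : {compact-open, X -> X}).
  move=> f; apply: continuous_comp; first exact: val_continuous.
  exact: id_continuous.
by move/continuousP : fun_continuous; exact.
Qed.

Lemma comp_val_continuous :
  continuous (fun p : set_type A * set_type A =>
    (\val p.1 \o \val p.2 : continuousType X X)).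
Proof.
have lX : locally_compact [set: X].
  move=> x _; rewrite withinET; exists setT; first exact: filterT.
  by split=> //; exact: closedT.
have rX : regular_space X.
  by move=> x; apply: (compact_regular Xhaus Xcompact); exact: filterT.
pose vals (p : set_type A * set_type A) := (\val p.1, \val p.2).
have vals_continuous : continuous vals.
  move=> p; apply: (@cvg_pair _ _ _ (nbhs p) (nbhs (\val p.1)) (nbhs (\val p.2))
    _ _ _ (fun q => \val q.1) (fun q => \val q.2)).
  - by apply: (cvg_comp _ _ cvg_fst); exact: val_continuous.
  - by apply: (cvg_comp _ _ cvg_snd); exact: val_continuous.
move=> p.
have := @compose_continuous X X X lX rX lX rX (vals p).
exact: (cvg_comp _ _ (vals_continuous p)).
Qed.

Lemma subset_fun_zero_dimensional :
  zero_dimensional X -> zero_dimensional (set_type A).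
Proof.
move=> Xzd f g fg.
have [x fgx] : exists x, subset_fun f x <> subset_fun g x.
  apply/existsNP => fgE; move/eqP: fg; apply; apply: val_inj.
  exact/continuousEP.
have [U [Uc Uf Ug]] := Xzd _ _ (introN eqP fgx).
exists ((fun h => subset_fun h x) @^-1` U); split=> //.
by apply: preimage_clopen => //; exact: eval_at_continuous.
Qed.

Lemma subset_fun_ptws_continuous :
  continuous (subset_fun : set_type A -> {ptws X -> X}).
Proof.
move=> f; have FF : Filter (subset_fun h @[h --> f]).
  by apply: fmap_filter; exact: nbhs_filter.
apply/cvg_sup => x B /= [_ [[O Oo <-] Ox OB]].
have : nbhs f ((fun h => subset_fun h x) @^-1` O).
  by apply: eval_at_continuous; exact: open_nbhs_nbhs.
by apply: filterS => h Oh; exact: OB.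
Qed.

End CompactOpen.

Theorem theorem5p6 (Q : topologicalQuandleType)
    (Qcompact : compact [set: Q]) (Qhausdorff : hausdorff_space Q)
    (Qtd : totally_disconnected [set: Q]) :
  (compact [set: qEnd Q] ->
     profinite_monoid (qEnd Q) /\
     forall A : set (qEnd Q), open A <-> @open (qEnd_ptws Q) A)
  /\
  (compact [set: qAut Q] ->
     profinite_group (qAut Q) /\
     forall A : set (qAut Q), open A <-> @open (qAut_ptws Q) A).
Proof.
have Qzd := compact_totally_disconnected_zero_dimensional
  Qcompact Qhausdorff Qtd.
have Qptws : hausdorff_space {ptws Q -> Q} by apply: hausdorff_product.
split=> [Ecompact|Acompact]; split.
- apply: compact_zero_dimensional_profinite_monoid => //.
    exact: (subset_fun_zero_dimensional (A := @end_set Q)).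
  apply: continuous_comp_initial.
  exact: (comp_val_continuous (A := @end_set Q)).
- apply: compact_hausdorff_initial => //.
    exact: (subset_fun_ptws_continuous (A := @end_set Q)).
  by move=> f g fg; apply: End_fun_inj => x; rewrite fg.
- apply: compact_zero_dimensional_profinite_group => //.
    exact: (subset_fun_zero_dimensional (A := @aut_set Q)).
  apply: continuous_comp_initial.
  exact: (comp_val_continuous (A := @aut_set Q)).
- apply: compact_hausdorff_initial => //.
    exact: (subset_fun_ptws_continuous (A := @aut_set Q)).
  by move=> f g fg; apply: Aut_fun_inj => x; rewrite fg.
Qed.
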